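(* Let $K$ be a field, let $\mathcal A$ define the simplicial toric ideal $I_{\mathcal A}\subset K[x_1,\dots,x_c,y_1,\dots,y_d]$, and let $S$ be the semigroup generated by $\mathcal A$. Assume that $K[S]$ is a generalized Cohen-Macaulay ring. Then the maximum degree in a minimal Gröbner basis of $I_{\mathcal A}$ with respect to the reverse lexicographic order is at most $\operatorname{reg}(I_{\mathcal A})$.
   Context: Setting. $K$ is an arbitrary field, $c\ge 2$, $\alpha\ge 2$ and $d$ are natural numbers, and $M_{\alpha,d}=\{(x_1,\dots,x_d)\in\mathbb N^d : x_1+\cdots+x_d=\alpha\}$ (with $0\in\mathbb N$). $\mathcal A=\{\mathbf e_1,\dots,\mathbf e_d,\mathbf a_1,\dots,\mathbf a_c\}\subseteq M_{\alpha,d}$ is a set of $d+c$ distinct elements, where $\mathbf e_1=(\alpha,0,\dots,0),\dots,\mathbf e_d=(0,\dots,0,\alpha)$. Writing $\mathbf a_i=(a_{i1},\dots,a_{id})$, the integers $a_{ij}$ ($1\le i\le c$, $1\le j\le d$) are assumed to be relatively prime (their overall gcd is $1$). $S\subseteq\mathbb N^d$ is the (homogeneous simplicial affine) semigroup (with $0$) generated by $\mathcal A$, and $K[S]\cong K[t_1^\alpha,\dots,t_d^\alpha,\mathbf t^{\mathbf a_1},\dots,\mathbf t^{\mathbf a_c}]\subseteq K[t_1,\dots,t_d]$, where $\mathbf t^{\mathbf a_i}=t_1^{a_{i1}}\cdots t_d^{a_{id}}$. $I_{\mathcal A}$ is the kernel of the $K$-algebra homomorphism $K[x_1,\dots,x_c,y_1,\dots,y_d]\to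 K[S]$, $x_i\mapsto \mathbf t^{\mathbf a_i}$, $y_j\mapsto t_j^\alpha$; it is called the simplicial toric ideal defined by $\mathcal A$, and $K[S]\cong K[x_1,\dots,x_c,y_1,\dots,y_d]/I_{\mathcal A}$. The grading is the standard one: $\deg x_i=\deg y_j=1$. Order. The reverse lexicographic order is the graded (degree) reverse lexicographic order with $x_1>\cdots>x_c>y_1>\cdots>y_d$. The maximum degree in a minimal Gröbner basis of $I_{\mathcal A}$ is the largest degree of a minimal generator of the initial ideal $\operatorname{in}(I_{\mathcal A})$. Definitions. For a homogeneous ideal $I$ of a standard graded polynomial ring $R$, $R/I$ is a generalized Cohen-Macaulay ring if all local cohomology modules $H^i_{\mathfrak m}(R/I)$, $i<\dim R/I$, with support in the maximal homogeneous ideal $\mathfrak m$ of $R/I$, have finite length. The Castelnuovo-Mumford regularity of a finitely generated graded $R$-module $M$ is $\operatorname{reg}(M)=\max\{n : [H^i_{\mathfrak m}(M)]_{n-i}\ne 0 \text{ for some } i\ge 0\}$; one has $\operatorname{reg}(I)=\operatorname{reg}(R/I)+1$. *)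

(* Defs.v *)
(* Mathematical Components with the multinomials library. *)
From HB Require Import structures.
From mathcomp Require Import all_boot all_order all_algebra.
From mathcomp Require Import ring_quotient mpoly.

Set Implicit Arguments.
Unset Strict Implicit.
Unset Printing Implicit Defensive.

Import GRing.Theory.
Local Open Scope ring_scope.

Section RevlexInitialIdeal.
Variables (K : fieldType) (n : nat).
Implicit Types (I : {pred {mpoly K[n]}}) (m : 'X_{1..n}) (p f : {mpoly K[n]}).

(* Degree reverse lexicographic order for X_0 > X_1 > ... > X_(n-1); this is
   not the order behind [mlead], which is degree lexicographic. *)
Definition revlex_lt m1 m2 : Prop :=
  (mdeg m1 < mdeg m2)%N \/
  mdeg m1 = mdeg m2 /\
  exists i : 'I_n, (m2 i < m1 i)%N /\ forall j : 'I_n, (i < j)%N -> m1 j = m2 j.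

Definition revlex_lead f m : Prop :=
  m \in msupp f /\ forall m', m' \in msupp f -> m' != m -> revlex_lt m' m.

Definition initial_ideal I p : Prop :=
  exists s : seq ({mpoly K[n]} * 'X_{1..n}),
    (forall t, t \in s -> exists2 f, f \in I & revlex_lead f t.2) /\
    p = \sum_(t <- s) t.1 * 'X_[t.2].

Definition min_generator (J : {mpoly K[n]} -> Prop) m : Prop :=
  J 'X_[m] /\ forall m', J 'X_[m'] -> (m' <= m)%MM -> m' = m.

Definition max_revlex_groebner_degree I (D : nat) : Prop :=
  (exists2 m, min_generator (initial_ideal I) m & mdeg m = D) /\
  forall m, min_generator (initial_ideal I) m -> (mdeg m <= D)%N.

End RevlexInitialIdeal.

(* Local cohomology of a subquotient N/L, for ideals L <= N of the polynomial
   ring R = K[X_0, ..., X_(n-1)], with support in (X_0, ..., X_(n-1)): the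
   cohomology of the Cech complex
     C^i(N/L) = \bigoplus_(#|F| = i) (N/L)_(X_F),   X_F = \prod_(k in F) X_k.
   By exactness of localization (N/L)_(X_F) is N_(X_F) / L_(X_F), and both
   terms are taken inside the fraction field of R.  The case N = R, L = I gives
   R/I, and the case N = I, L = 0 gives the module I itself. *)
Section LocalCohomology.
Variables (K : fieldType) (n : nat).
Local Notation R := {mpoly K[n]}.
Local Notation Q := {fraction {mpoly K[n]}}.
Local Notation cochainType := {ffun {set 'I_n} -> Q}.
Implicit Types (N L I : {pred R}) (F G : {set 'I_n}) (u v w : cochainType).

Definition Xprod F : R := \prod_(k in F) 'X_k.

Definition localized N F (z : Q) : Prop :=
  exists (k : nat) (p : R), p \in N /\ z = tofrac p / tofrac (Xprod F ^+ k).

Definition cochain N (i : nat) u : Prop :=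
  forall F, if #|F| == i then localized N F (u F) else u F = 0.

Definition cech_diff u : cochainType :=
  [ffun G : {set 'I_n} =>
    \sum_(j in G) (-1) ^+ #|[set k in G | (k < j)%N]| * u (G :\ j)].

Definition cocycle N L (i : nat) u : Prop :=
  cochain N i u /\ cochain L i.+1 (cech_diff u).

Definition coboundary N L (i : nat) u : Prop :=
  match i with
  | 0 => cochain L 0 u
  | j.+1 => exists2 v, cochain N j v & cochain L j.+1 (u - cech_diff v)
  end.

Definition submodule (W : cochainType -> Prop) : Prop :=
  W 0 /\ forall (r : R) u v, W u -> W v -> W ([ffun F => tofrac r * u F] + v).

(* The R-module H^i(N/L) has finite length: the strictly increasing chains
   W_0 < ... < W_l of R-modules between the coboundaries and the cocycles
   have bounded length l. *)
Definition local_cohomology_finite_length N L (i : nat) : Prop :=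
  exists b : nat, forall (l : nat) (W : nat -> cochainType -> Prop),
    (forall k, (k <= l)%N ->
      [/\ submodule (W k),
          forall u, coboundary N L i u -> W k u &
          forall u, W k u -> cocycle N L i u]) ->
    (forall k, (k < l)%N ->
      (forall u, W k u -> W k.+1 u) /\ exists u, W k.+1 u /\ ~ W k u) ->
    (l <= b)%N.

Definition frac_homog (e : int) (z : Q) : Prop :=
  exists (h : nat) (p : R) (m : 'X_{1..n}),
    [/\ p \is h.-homog, z = tofrac p / tofrac 'X_[m]
      & h%:Z - (mdeg m)%:Z = e].

(* [H^i(N/L)]_e <> 0, for homogeneous N and L *)
Definition local_cohomology_nonzero N L (i : nat) (e : int) : Prop :=
  exists u, [/\ cocycle N L i u, forall F, frac_homog e (u F)
              & ~ coboundary N L i u].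

Definition castelnuovo_mumford_regularity N L (r : int) : Prop :=
  (exists i : nat, local_cohomology_nonzero N L i (r - i%:Z)) /\
  forall (s : int) (i : nat), local_cohomology_nonzero N L i (s - i%:Z) -> s <= r.

Definition regularity_ideal I (r : int) : Prop :=
  castelnuovo_mumford_regularity I (pred1 0) r.

(* i < dim R/I; prime ideals of R/I are the prime ideals of R containing I *)
Definition lt_krull_dim I (i : nat) : Prop :=
  exists P : nat -> {pred R},
    (forall k, (k <= i.+1)%N ->
      [/\ idealr_closed (P k), prime_idealr_closed (P k)
        & {subset I <= P k}]) /\
    (forall k, (k < i.+1)%N ->
      {subset P k <= P k.+1} /\ exists2 p, p \in P k.+1 & p \notin P k).

Definition generalized_Cohen_Macaulay_quotient I : Prop :=
  forall i, lt_krull_dim I i -> local_cohomology_finite_length predT I i.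

End LocalCohomology.

Section ToricIdeal.
Variables (K : fieldType) (c d : nat) (alpha : nat) (a : 'I_c -> 'X_{1..d}).

Definition pure_power (j : 'I_d) : 'X_{1..d} := (U_(j) *+ alpha)%MM.

Definition simplicial_data : Prop :=
  [/\ forall i, mdeg (a i) = alpha,
      injective a,
      forall i j, a i != pure_power j
    & \big[gcdn/0%N]_(i < c) \big[gcdn/0%N]_(j < d) a i j = 1%N].

(* The first c variables are x_1, ..., x_c, the last d are y_1, ..., y_d. *)
Definition toric_exponent (k : 'I_(c + d)) : 'X_{1..d} :=
  match split k with inl i => a i | inr j => pure_power j end.

(* The kernel of x_i |-> t^(a_i), y_j |-> t_j^alpha; its quotient is K[S]. *)
Definition toric_ideal : {pred {mpoly K[c + d]}} :=
  [pred f | f \mPo [tuple 'X_[toric_exponent k] : {mpoly K[d]} | k < c + d] == 0].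

End ToricIdeal.

Arguments toric_ideal K {c d} alpha a.

(* Main.v *)
From HB Require Import structures.
Require Import Defs.
From mathcomp Require Import all_boot all_order all_algebra.
From mathcomp Require Import ring_quotient mpoly.
From mathcomp Require Import zify ring.
From Stdlib Require Import Classical.

(* Write S_T = S - N{alpha e_t : t in T}.  In a multidegree s of ZZ^d the Cech
   complex of K[S] only depends on the set of T with s in S_T.  If T is maximal
   with s notin S_T and |T| <= d - 2, then H^(|T|+1) is nonzero in all degrees
   s - N (sum of alpha e_t, t in T), N >> 0; so the generalized Cohen-Macaulay
   property forces T to be empty, and then H^1 is nonzero in degree s.

   Let m be a minimal generator of in(I), v the last variable dividing m, and s
   the multidegree of m / v.  By minimality s - alpha e_k is not in S whenever
   y_k is smaller than v.  If v = y_j, the other monomials of an element of I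
   with leading term m give some k > j with s - alpha e_k + alpha e_j in S, so
   every T with s - alpha e_k notin S_T omits both j and k, and
   H^1 is nonzero in degree s - alpha e_k.  If v is one of the x_i, either the
   same holds for some k, or s - sum_k alpha e_k avoids S_T for all T <> [d] and
   H^d is nonzero there.  In each case reg K[S] >= deg m - 1.

   Since H^i(R/I) -> H^(i+1)(I) is injective for i <= d, the classes survive as
   classes of I; this is checked by hand on the coefficients of the cochains. *)

Set Implicit Arguments.
Unset Strict Implicit.
Unset Printing Implicit Defensive.

Import Order.TTheory GRing.Theory Num.Theory.
Local Open Scope ring_scope.

(** * Exterior multiplication by one-forms on functions of finite sets *)

Section Wedge.
Variables (n : nat) (A : comNzRingType).
Implicit Types (om : 'I_n -> A) (u : {set 'I_n} -> A) (F G : {set 'I_n}).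

Definition before G (j : 'I_n) : nat := #|[set k in G | (k < j)%N]|.

(** The coefficient at e_G of (sum of om_j e_j) ∧ (sum of u_F e_F); the form with all coefficients 1
    gives the Cech differential. *)
Definition wedge om u G : A :=
  \sum_(j in G) (-1) ^+ before G j * (om j * u (G :\ j)).

Lemma beforeD1 G (i j : 'I_n) : j \in G ->
  before G i = (before (G :\ j) i + (j < i))%N.
Proof.
move=> jG; rewrite /before; case: (ltnP j i) => ji; last first.
  rewrite addn0; apply: eq_card => k; rewrite !inE.
  by case: (k =P j) => //= ->; rewrite jG ltnNge ji.
rewrite (cardsD1 j) !inE jG ji addnC; congr (_ + _)%N.
by apply: eq_card => k; rewrite !inE andbA.
Qed.

(** Removing i and j from G in the two possible orders gives opposite signs, so the terms pair up
    into 2 x 2 minors, which are alternating in the two forms. *)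
Lemma wedge_wedge om1 om2 u G :
  wedge om1 (wedge om2 u) G =
  \sum_(j in G) \sum_(i in G | (i < j)%N)
     (-1) ^+ (before G i + before G j) * (om1 j * om2 i - om1 i * om2 j)
     * u (G :\ j :\ i).
Proof.
pose e i j := (-1) ^+ (before G i + before G j) * (om1 j * om2 i) * u (G :\ j :\ i).
(* Removing j lowers the position of i exactly when j < i; this is the source of the minus sign. *)
have inner j : j \in G ->
  (-1) ^+ before G j * (om1 j * wedge om2 u (G :\ j)) =
  \sum_(i in G | (i < j)%N) e i j - \sum_(i in G | (j < i)%N) e i j.
  move=> jG; rewrite /wedge [in LHS](bigID (fun i : 'I_n => (i < j)%N)) /=.
  rewrite !mulrDr !mulr_sumr; congr (_ + _).
    apply: eq_big => [i|i /andP[]]; rewrite !inE.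
      by have [->|] := eqVneq i j; rewrite ?ltnn ?andbF.
    move=> /andP[ij iG] lij; rewrite /e (beforeD1 i jG).
    rewrite ltnNge (ltnW lij) addn0 exprD; ring.
  rewrite -sumrN; apply: eq_big => [i|i /andP[]]; rewrite !inE.
    have [->|ne] := eqVneq i j; first by rewrite ltnn andbF.
    by rewrite -leqNgt leq_eqVlt eq_sym (inj_eq val_inj) (negPf ne).
  move=> /andP[ij iG]; rewrite -leqNgt leq_eqVlt eq_sym (inj_eq val_inj) (negPf ij) /= => lij.
  by rewrite /e (beforeD1 i jG) lij !exprD expr1; ring.
transitivity (\sum_(j in G) (\sum_(i in G | (i < j)%N) e i j -
                             \sum_(i in G | (j < i)%N) e i j)).
  exact: eq_bigr.
rewrite big_split /= sumrN.
have -> : \sum_(j in G) \sum_(i in G | (j < i)%N) e i j =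
          \sum_(j in G) \sum_(i in G | (i < j)%N) e j i.
  rewrite (exchange_big_dep (mem G)) /=; last by move=> i j _ /andP[].
  by apply: eq_bigr => j jG; apply: eq_bigl => i; rewrite jG.
rewrite -sumrB; apply: eq_bigr => j jG; rewrite -sumrB.
apply: eq_bigr => i /andP[iG ij]; rewrite /e.
have -> : G :\ i :\ j = G :\ j :\ i by apply/setP => k; rewrite !inE andbCA.
by rewrite !exprD; ring.
Qed.

Lemma wedgexx om u G : wedge om (wedge om u) G = 0.
Proof.
rewrite wedge_wedge big1 // => j _; rewrite big1 // => i _.
by rewrite [om j * _]mulrC subrr mulr0 mul0r.
Qed.

Lemma wedgeC om1 om2 u G : wedge om1 (wedge om2 u) G = - wedge om2 (wedge om1 u) G.
Proof.
rewrite !wedge_wedge -sumrN; apply: eq_bigr => j _; rewrite -sumrN.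
by apply: eq_bigr => i _; ring.
Qed.

Lemma eq_wedge om u1 u2 : u1 =1 u2 -> wedge om u1 =1 wedge om u2.
Proof. by move=> e G; apply: eq_bigr => j _; rewrite e. Qed.

Lemma wedge0r om u G : u =1 (fun=> 0) -> wedge om u G = 0.
Proof. by move=> e; rewrite /wedge big1 // => j _; rewrite e !mulr0. Qed.

Lemma wedge_suml (I : Type) (r : seq I) (P : pred I) (om : I -> 'I_n -> A) u G :
  wedge (fun v => \sum_(t <- r | P t) om t v) u G =
  \sum_(t <- r | P t) wedge (om t) u G.
Proof.
rewrite /wedge exchange_big; apply: eq_bigr => j _ /=.
by rewrite mulr_suml mulr_sumr.
Qed.

Variables (I : finType) (om : I -> 'I_n -> A).

(** The product of the forms [om t], t in s: its value at F is the minor of the matrix (om t v) with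
    rows s and columns F. *)
Definition wedges (s : seq I) : {set 'I_n} -> A :=
  foldr (fun t u => wedge (om t) u) (fun F => (F == set0)%:R) s.

(** Anticommutation moves the outer form inwards until it meets its own copy. *)
Lemma wedge_wedges t s G : t \in s -> wedge (om t) (wedges s) G = 0.
Proof.
elim: s G => // t' s IH G; rewrite inE /= => /orP[/eqP <-|ts].
  exact: wedgexx.
by rewrite wedgeC wedge0r ?oppr0 // => F; rewrite IH.
Qed.

Lemma wedge_supp om' u G : wedge om' u G != 0 ->
  exists2 j, j \in G & om' j != 0 /\ u (G :\ j) != 0.
Proof.
move=> nz; apply: NNPP => H; case/eqP: nz; apply: big1 => j jG.
have [->|h1] := eqVneq (om' j) 0; first by rewrite mul0r mulr0.
have [->|h2] := eqVneq (u (G :\ j)) 0; first by rewrite !mulr0.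
by case: H; exists j.
Qed.

Lemma wedges_supp s F : wedges s F != 0 ->
  #|F| = size s /\ forall t, t \in s -> exists2 v, v \in F & om t v != 0.
Proof.
elim: s F => [|t s IH] F /=.
  by case: (F =P set0) => [-> _|_]; rewrite ?eqxx // cards0.
case/wedge_supp=> j jF [oj /IH[sz IHs]]; rewrite (cardsD1 j) jF sz; split=> // t'.
rewrite inE => /orP[/eqP->|/IHs[v]]; first by exists j.
by rewrite !inE => /andP[_ vF] ov; exists v.
Qed.

Lemma wedge_sign om' u G j : j \in G -> om' j = 1 ->
  (forall i, i \in G -> i != j -> om' i = 0 \/ u (G :\ i) = 0) ->
  (exists k : nat, u (G :\ j) = (-1) ^+ k) -> exists k : nat, wedge om' u G = (-1) ^+ k.
Proof.
move=> jG oj H [k uk]; exists (before G j + k)%N.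
rewrite /wedge (bigD1 j) //= big1 ?addr0 ?oj ?uk ?mul1r ?exprD // => i /andP[iG ij].
by case: (H i iG ij) => ->; rewrite ?mulr0 ?mul0r ?mulr0.
Qed.

(** On the columns y t the matrix is a permutation matrix, so its minor is a sign. *)
Lemma wedges_sign (y : I -> 'I_n) s : injective y -> uniq s ->
  (forall t t', t \in s -> om t (y t') = (t == t')%:R) ->
  exists k : nat, wedges s [set y t | t in s] = (-1) ^+ k.
Proof.
move=> yI; elim: s => [|t s IH] /= => [_ _|/andP[ts us] H].
  exists 0%N; rewrite (_ : [set _ | _ in _] = set0) ?eqxx //; apply/setP => v.
  by rewrite inE; apply/imsetP => -[].
have tS : y t \in [set y x | x in t :: s] by apply/imsetP; exists t; rewrite ?inE ?eqxx.
apply: (wedge_sign (j := y t)) => //; first by rewrite H ?inE ?eqxx.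
  move=> i /imsetP[t' _ ->] ne; left; rewrite H ?inE ?eqxx //.
  by case: (t =P t') ne => // ->; rewrite eqxx.
suff -> : [set y x | x in t :: s] :\ y t = [set y x | x in s].
  by apply: IH => // t1 t2 h; apply: H; rewrite inE h orbT.
apply/setP => v; rewrite !inE; apply/andP/imsetP.
  by case=> vt /imsetP[t']; rewrite inE => /orP[/eqP->|h] e; [rewrite e eqxx in vt|exists t'].
case=> t' h ->; split; last by apply/imsetP; exists t'; rewrite ?inE ?h ?orbT.
by apply: contra ts => /eqP /yI <-.
Qed.

End Wedge.

(** * Fractions with denominators [Xprod F ^+ k] *)

Section Localization.
Variables (K : fieldType) (n : nat).
Local Notation R := {mpoly K[n]}.
Local Notation Q := {fraction {mpoly K[n]}}.
Implicit Types (F G : {set 'I_n}) (p q : R) (z : Q).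

Definition loc_frac F k p : Q := tofrac p / tofrac (Xprod K F ^+ k).

Definition set_mnm F : 'X_{1..n} := (\sum_(k in F) U_(k))%MM.

Lemma set_mnmE F k : set_mnm F k = (k \in F) :> nat.
Proof.
rewrite /set_mnm mnm_sumE; have [kF|kF] := boolP (k \in F).
  rewrite (bigD1 k) //= mnm1E eqxx big1 // => i /andP[_ ik].
  by rewrite mnm1E (negPf ik).
by rewrite big1 // => i iF; rewrite mnm1E; case: (i =P k) iF kF => // -> ->.
Qed.

Lemma XprodE F : Xprod K F = 'X_[set_mnm F].
Proof. exact: mprodXE. Qed.

Lemma XprodXE F k : Xprod K F ^+ k = 'X_[set_mnm F *+ k].
Proof. by rewrite XprodE mpolyXn. Qed.

Lemma Xprod_neq0 F k : Xprod K F ^+ k != 0.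
Proof. by rewrite XprodXE -msupp_eq0 msuppX. Qed.

Lemma tofrac_Xprod_neq0 F k : tofrac (Xprod K F ^+ k) != 0 :> Q.
Proof. by rewrite tofrac_eq0 Xprod_neq0. Qed.

Lemma XprodU F G : F \subset G -> Xprod K G = Xprod K F * Xprod K (G :\: F).
Proof.
move=> FG; rewrite !XprodE -mpolyXD; congr 'X_[_]; apply/mnmP => i.
rewrite mnmDE !set_mnmE !inE; case: (boolP (i \in F)) => iF /=.
  by rewrite (subsetP FG).
by [].
Qed.

Lemma loc_frac_eq F F' k k' p p' :
  loc_frac F k p = loc_frac F' k' p' <-> p * Xprod K F' ^+ k' = p' * Xprod K F ^+ k.
Proof.
rewrite /loc_frac; split=> [/eqP|E]; last first.
  by apply/eqP; rewrite eqr_div ?tofrac_Xprod_neq0 // -!tofracM E.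
by rewrite eqr_div ?tofrac_Xprod_neq0 // -!tofracM tofrac_eq => /eqP.
Qed.

Lemma loc_frac_lift F G k p : F \subset G ->
  loc_frac F k p = loc_frac G k (p * Xprod K (G :\: F) ^+ k).
Proof.
by move=> FG; apply/loc_frac_eq; rewrite -mulrA -exprMn [_ * Xprod K F]mulrC -XprodU.
Qed.

Lemma loc_frac_raise F j k p : loc_frac F k p = loc_frac F (j + k) (p * Xprod K F ^+ j).
Proof. by apply/loc_frac_eq; rewrite -mulrA exprD. Qed.

Lemma loc_fracD F k p q : loc_frac F k (p + q) = loc_frac F k p + loc_frac F k q.
Proof. by rewrite /loc_frac tofracD mulrDl. Qed.

Lemma loc_frac0 F k : loc_frac F k 0 = 0.
Proof. by rewrite /loc_frac tofrac0 mul0r. Qed.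

Lemma loc_fracM F k p q : tofrac p * loc_frac F k q = loc_frac F k (p * q).
Proof. by rewrite /loc_frac tofracM mulrA. Qed.

Lemma loc_frac_inj F k p q : loc_frac F k p = loc_frac F k q -> p = q.
Proof. by move/loc_frac_eq/(mulIf (Xprod_neq0 _ _)). Qed.

(** Unlike [idealr_closed] this admits the unit ideal, so that [predT], the toric ideal and the zero
    ideal are treated alike. *)
Definition ideal_like (N : {pred R}) : Prop :=
  [/\ 0 \in N, forall p q, p \in N -> q \in N -> p + q \in N
    & forall p q, p \in N -> p * q \in N].

Lemma predT_ideal : ideal_like predT.
Proof. by []. Qed.

Lemma localized_raise N F z : ideal_like N -> localized N F z ->
  exists k0, forall k, (k0 <= k)%N -> exists2 p, p \in N & z = loc_frac F k p.
Proof.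
case=> _ _ NM [k0 [p [pN ->]]]; exists k0 => k /subnK <-.
exists (p * Xprod K F ^+ (k - k0)); first exact: NM.
exact: loc_frac_raise.
Qed.

Lemma localizedD N F z1 z2 : ideal_like N ->
  localized N F z1 -> localized N F z2 -> localized N F (z1 + z2).
Proof.
move=> IN /(localized_raise IN)[k1 H1] /(localized_raise IN)[k2 H2].
have [p1 p1N ->] := H1 (k1 + k2)%N (leq_addr _ _).
have [p2 p2N ->] := H2 (k1 + k2)%N (leq_addl _ _).
by exists (k1 + k2)%N, (p1 + p2); split; [case: IN => _ + _; apply|rewrite -loc_fracD].
Qed.

Lemma localizedM N F r z : ideal_like N -> localized N F z -> localized N F (tofrac r * z).
Proof.
case=> _ _ NM [k [p [pN ->]]]; exists k, (r * p); split; first by rewrite mulrC NM.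
exact: loc_fracM.
Qed.

Lemma localized0 N F : ideal_like N -> localized N F 0.
Proof. by case=> N0 _ _; exists 0%N, 0; split=> //; rewrite tofrac0 mul0r. Qed.

Lemma localized_sub N F G z : ideal_like N -> F \subset G ->
  localized N F z -> localized N G z.
Proof.
case=> _ _ NM FG [k [p [pN ->]]]; exists k, (p * Xprod K (G :\: F) ^+ k).
by split; [exact: NM | exact: loc_frac_lift].
Qed.

Lemma localized_subr N N' F z : {subset N <= N'} -> localized N F z -> localized N' F z.
Proof. by move=> NN' [k [p [pN ->]]]; exists k, p; split=> //; exact: NN'. Qed.

(** Exponents of denominators can be raised freely, so the maximum over the finite index type serves
    for all the fractions. *)
Lemma localized_bound (I : finType) (F : I -> {set 'I_n}) N (P : pred I) (z : I -> Q) :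
  ideal_like N -> (forall i, P i -> localized N (F i) (z i)) ->
  exists k0, forall k i, (k0 <= k)%N -> P i ->
    exists2 p, p \in N & z i = loc_frac (F i) k p.
Proof.
move=> IN H; suff /fin_all_exists[f Hf] : forall i, exists k0, forall k, (k0 <= k)%N -> P i ->
    exists2 p, p \in N & z i = loc_frac (F i) k p.
  exists (\max_i f i)%N => k i kf; apply: (Hf i).
  exact: leq_trans (leq_bigmax i) kf.
move=> i; case: (boolP (P i)) => Pi; last by exists 0%N.
have [k0 Hk] := localized_raise IN (H i Pi); exists k0 => k kk _; exact: Hk.
Qed.

End Localization.

(** * Cech cochains and homogeneous fractions *)

Section Cochains.
Variables (K : fieldType) (n : nat).
Local Notation R := {mpoly K[n]}.
Local Notation Q := {fraction {mpoly K[n]}}.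
Local Notation cochainType := {ffun {set 'I_n} -> Q}.
Implicit Types (N : {pred R}) (u v : cochainType).

Lemma cech_diffE u G : cech_diff u G = wedge (fun=> 1) u G.
Proof. by rewrite ffunE; apply: eq_bigr => j _; rewrite mul1r. Qed.

Lemma cech_diffK u : cech_diff (cech_diff u) = 0.
Proof.
apply/ffunP => G; rewrite cech_diffE (eq_wedge _ (cech_diffE u)) wedgexx.
by rewrite ffunE.
Qed.

Lemma cech_diff_lin (r : Q) u v :
  cech_diff ([ffun F => r * u F] + v) = [ffun F => r * cech_diff u F] + cech_diff v.
Proof.
apply/ffunP => G; rewrite !(ffunE, cech_diffE) /wedge mulr_sumr -big_split /=.
by apply: eq_bigr => j _; rewrite !ffunE; ring.
Qed.

Lemma cech_diffB u v : cech_diff (u - v) = cech_diff u - cech_diff v.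
Proof.
apply/ffunP => G; rewrite !(ffunE, cech_diffE) /wedge -sumrB.
by apply: eq_bigr => j _; rewrite !ffunE; ring.
Qed.

Lemma cochain_lin N i r u v : ideal_like N -> cochain N i u -> cochain N i v ->
  cochain N i ([ffun F => tofrac r * u F] + v).
Proof.
move=> IN Hu Hv F; move: (Hu F) (Hv F); rewrite !ffunE; case: ifP => _ H1 H2.
  by apply: localizedD => //; exact: localizedM.
by rewrite H1 H2 mulr0 addr0.
Qed.

Lemma cochain0 N i : ideal_like N -> cochain N i 0.
Proof. by move=> IN F; rewrite ffunE; case: ifP => // _; exact: localized0. Qed.

Lemma cochainB N i u v : ideal_like N -> cochain N i u -> cochain N i v ->
  cochain N i (u - v).
Proof.
move=> IN Hu Hv; have -> : u - v = [ffun F => tofrac (- 1 : R) * v F] + u.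
  by apply/ffunP => F; rewrite !ffunE tofracN tofrac1 mulN1r addrC.
exact: cochain_lin.
Qed.

Lemma cochain_subr N N' i u : {subset N <= N'} -> cochain N i u -> cochain N' i u.
Proof.
by move=> NN' H F; move: (H F); case: ifP => // _; exact: localized_subr.
Qed.

Lemma tofrac_sign k : (-1) ^+ k = tofrac ((-1) ^+ k : R) :> Q.
Proof. by rewrite tofracXn tofracN tofrac1. Qed.

Lemma cochain_diff N i u : ideal_like N -> cochain N i u -> cochain N i.+1 (cech_diff u).
Proof.
move=> IN Hu G; rewrite ffunE; case: ifP => [/eqP Gi|Gi].
  apply: (big_ind (localized N G)) => [|z1 z2|j jG]; first exact: localized0.
    exact: localizedD.
  rewrite tofrac_sign; apply: localizedM => //; apply: (localized_sub IN (subD1set G j)).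
  move: (Hu (G :\ j)); rewrite (_ : #|_| == i) //.
  by move: Gi; rewrite (cardsD1 j) jG add1n => -[->].
apply: big1 => j jG; move: (Hu (G :\ j)); case: ifP => [/eqP E|_ ->]; last by rewrite mulr0.
by move: Gi; rewrite (cardsD1 j) jG E add1n eqxx.
Qed.

Lemma cocycle_submodule N L i : ideal_like N -> ideal_like L -> submodule (cocycle N L i).
Proof.
move=> IN IL; split.
  split; first exact: cochain0.
  suff -> : cech_diff (0 : cochainType) = 0 by exact: cochain0.
  by apply/ffunP => G; rewrite !ffunE big1 // => j _; rewrite ffunE mulr0.
move=> r u v [u1 u2] [v1 v2]; split; first exact: cochain_lin.
by rewrite cech_diff_lin; exact: cochain_lin.
Qed.

(** The variable [k] supplies the denominator when [e] is negative. *)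
Lemma frac_homog0 (k : 'I_n) e : frac_homog e (0 : Q).
Proof.
case: e => h.
  by exists h, 0, 0%MM; rewrite dhomog0 mdeg0 tofrac0 mul0r subr0.
exists 0%N, 0, (U_(k) *+ h.+1)%MM.
by rewrite dhomog0 tofrac0 mul0r mdegMn mdeg1 mul1n sub0r.
Qed.

Lemma frac_homogD e z1 z2 : frac_homog e (z1 : Q) -> frac_homog e z2 -> frac_homog e (z1 + z2).
Proof.
move=> [h1 [p1 [m1 [H1 -> <-]]]] [h2 [p2 [m2 [H2 -> E2]]]].
exists (h1 + mdeg m2)%N, (p1 * 'X_[m2] + p2 * 'X_[m1]), (m1 + m2)%MM; split.
- apply: dhomogD; first by apply: dhomogM; rewrite // dhomogX.
  have -> : (h1 + mdeg m2 = h2 + mdeg m1)%N by lia.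
  by apply: dhomogM; rewrite // dhomogX.
- have nz m : tofrac ('X_[m] : R) != 0 by rewrite tofrac_eq0 -msupp_eq0 msuppX.
  rewrite addf_div ?nz // -!tofracM -tofracD mpolyXD.
  by congr (_ / _); congr tofrac; ring.
- rewrite mdegD; lia.
Qed.

Lemma frac_homog_sign e k z : frac_homog e (z : Q) -> frac_homog e ((-1) ^+ k * z).
Proof.
move=> [h [p [m [H -> <-]]]]; exists h, ((-1) ^+ k * p), m; split=> //.
  by rewrite -signr_odd mulr_sign; case: ifP; rewrite // rpredN.
by rewrite tofrac_sign mulrA -tofracM.
Qed.

End Cochains.

Ltac mnm_lia :=
  repeat match goal with H : _ = _ |- _ => move/mnmP: H => H end;
  let i := fresh "i" in apply/mnmP => i;
  repeat match goal with H : eqfun _ _ |- _ => move: {H} (H i) end;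
  rewrite ?(mnmDE, mulmnE, mnm0E, mulnDl, mulnDr);
  repeat match goal with |- context [fun_of_multinom ?m ?i] =>
    move: (fun_of_multinom m i) => ? end;
  lia.

Lemma mcoeff_mulX (A : nzRingType) n (p : {mpoly A[n]}) (m y : 'X_{1..n}) :
  (p * 'X_[m])@_y != 0 -> exists2 y', p@_y' != 0 & y = (y' + m)%MM.
Proof.
rewrite -mcoeff_msupp (perm_mem (msuppMX p m)) => /mapP[y' y'p ->].
by exists y'; rewrite -?mcoeff_msupp // addmC.
Qed.

Lemma mcoeff_sign (A : nzRingType) n (p : {mpoly A[n]}) k m :
  ((-1) ^+ k * p)@_m = (-1) ^+ k * p@_m.
Proof.
rewrite -(signr_odd {mpoly _[_]} k) -(signr_odd A k).
by case: (odd k); rewrite ?expr0 ?expr1 ?mulN1r ?mul1r ?mcoeffN.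
Qed.

(** * The toric map, multidegrees and the graded pieces of localizations of K[S] *)

Section Toric.
Variables (K : fieldType) (c d alpha : nat) (a : 'I_c -> 'X_{1..d}).
Local Notation n := (c + d)%N.
Local Notation R := {mpoly K[n]}.
Local Notation Q := {fraction {mpoly K[n]}}.
Local Notation cochainType := {ffun {set 'I_n} -> Q}.
Local Notation I := (toric_ideal K alpha a).
Local Notation tx := (toric_exponent alpha a).
Implicit Types (F G : {set 'I_n}) (p q : R) (z : Q) (b h : 'X_{1..d}) (T : {set 'I_d}).

Definition toric_map p : {mpoly K[d]} :=
  p \mPo [tuple 'X_[tx k] : {mpoly K[d]} | k < n].

HB.instance Definition _ := GRing.RMorphism.copy toric_map
  (comp_mpoly [tuple 'X_[tx k] : {mpoly K[d]} | k < n]).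

Lemma toric_mapZ r p : toric_map (r *: p) = r *: toric_map p.
Proof. exact: comp_mpolyZ. Qed.

Definition toric_deg (m : 'X_{1..n}) : 'X_{1..d} := (\sum_(k < n) tx k *+ m k)%MM.

Lemma toric_degE m j : toric_deg m j = (\sum_(k < n) tx k j * m k)%N.
Proof. by rewrite mnm_sumE; apply: eq_bigr => k _; rewrite mulmnE. Qed.

Lemma toric_degD m1 m2 : toric_deg (m1 + m2) = (toric_deg m1 + toric_deg m2)%MM.
Proof.
apply/mnmP => j; rewrite mnmDE !toric_degE -big_split; apply: eq_bigr => k _ /=.
by rewrite mnmDE mulnDr.
Qed.

Lemma toric_degMn m k : toric_deg (m *+ k) = (toric_deg m *+ k)%MM.
Proof.
apply/mnmP => j; rewrite mulmnE !toric_degE big_distrl; apply: eq_bigr => i _ /=.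
by rewrite mulmnE mulnA.
Qed.

Lemma toric_deg0 : toric_deg 0 = 0%MM.
Proof. by apply/mnmP => j; rewrite toric_degE mnm0E big1 // => k _; rewrite mnm0E muln0. Qed.

Lemma toric_degU k : toric_deg U_(k) = tx k.
Proof.
apply/mnmP => j; rewrite toric_degE (bigD1 k) //= mnm1E eqxx muln1 big1 ?addn0 // => i ik.
by rewrite mnm1E eq_sym (negPf ik) muln0.
Qed.

Lemma toric_mapX m : toric_map 'X_[m] = 'X_[toric_deg m].
Proof.
rewrite /toric_map comp_mpolyX /toric_deg -mprodXnE.
by apply: eq_bigr => k _; rewrite tnth_mktuple.
Qed.

Lemma mem_toric p : (p \in I) = (toric_map p == 0).
Proof. by []. Qed.

Lemma toric_ideal_like : ideal_like I.
Proof.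
split=> [|p q|p q]; rewrite !mem_toric ?rmorph0 //.
  by move=> /eqP p0 /eqP q0; rewrite rmorphD /= p0 q0 addr0.
by move=> /eqP p0; rewrite rmorphM /= p0 mul0r.
Qed.

Lemma mcoeff_toric p y : (toric_map p)@_y = \sum_(m <- msupp p | toric_deg m == y) p@_m.
Proof.
rewrite [in LHS](mpolyE p) (raddf_sum toric_map) (raddf_sum (mcoeff y)) /=.
rewrite [RHS]big_mkcond /=; apply: eq_bigr => m _.
by rewrite toric_mapZ toric_mapX mcoeffZ mcoeffX; case: eqP; rewrite ?mulr1 ?mulr0.
Qed.

Lemma toric_mcoeff_neq0 p y : (toric_map p)@_y != 0 ->
  exists2 m, p@_m != 0 & toric_deg m = y.
Proof.
rewrite mcoeff_toric => nz; apply: NNPP => H; case/eqP: nz; rewrite big_seq_cond big1 // => m.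
case/andP; rewrite mcoeff_msupp => pm /eqP my; case: H; by exists m.
Qed.

Definition set_deg F := toric_deg (set_mnm F).

(* The multidegree [b - h] of [ZZ^d] occurs in the localization of [K[S]] at the
   images of the variables in [F]. *)
Definition in_loc b h F : Prop :=
  exists k m, (b + set_deg F *+ k = h + toric_deg m)%MM.

Lemma toric_map_Xprod F k : toric_map (Xprod K F ^+ k) = 'X_[set_deg F *+ k].
Proof. by rewrite XprodXE toric_mapX toric_degMn. Qed.

Lemma set_deg_setD F G : F \subset G -> set_deg G = (set_deg F + set_deg (G :\: F))%MM.
Proof.
move=> FG; rewrite /set_deg -toric_degD; congr toric_deg; apply/mnmP => i.
rewrite mnmDE !set_mnmE !inE; case: (boolP (i \in F)) => iF //=.
by rewrite (subsetP FG).
Qed.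

Lemma in_loc_addh b h m F : in_loc b (h + toric_deg m) F -> in_loc b h F.
Proof. move=> [k [m' E]]; exists k, (m + m')%MM; rewrite toric_degD; mnm_lia. Qed.

(* The image of [z] in the fraction field of [K[t]] is [r t^(b - h)]. *)
Definition monomial_value b h F z (r : K) : Prop :=
  exists k p, z = loc_frac F k p /\ 'X_[h] * toric_map p = r *: 'X_[b + set_deg F *+ k].

Lemma monomial_valueD b h F z1 z2 r1 r2 : monomial_value b h F z1 r1 ->
  monomial_value b h F z2 r2 -> monomial_value b h F (z1 + z2) (r1 + r2).
Proof.
move=> [k1 [p1 [-> E1]]] [k2 [p2 [-> E2]]].
exists (k1 + k2)%N, (p1 * Xprod K F ^+ k2 + p2 * Xprod K F ^+ k1); split.
  by rewrite (loc_frac_raise F k2 k1) (loc_frac_raise F k1 k2) [(k2 + k1)%N]addnC -loc_fracD.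
rewrite rmorphD !rmorphM /= !toric_map_Xprod mulrDr !mulrA E1 E2 scalerDl -!scalerAl -!mpolyXD.
by congr (_ *: 'X_[_] + _ *: 'X_[_]); mnm_lia.
Qed.

Lemma monomial_value0 b h F : monomial_value b h F 0 0.
Proof.
exists 0%N, 0; split; first by rewrite loc_frac0.
by rewrite rmorph0 mulr0 scale0r.
Qed.

Lemma monomial_value_sign b h F z r k : monomial_value b h F z r ->
  monomial_value b h F ((-1) ^+ k * z) ((-1) ^+ k * r).
Proof.
move=> [k1 [p1 [-> E1]]]; exists k1, ((-1) ^+ k * p1); split.
  by rewrite -loc_fracM tofrac_sign.
rewrite rmorphM rmorph_sign mulrCA E1 -scalerA -(signr_odd {mpoly _[_]} k) -(signr_odd K k).
by case: (odd k); rewrite ?expr0 ?expr1 ?mulN1r ?scaleN1r ?mul1r ?scale1r.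
Qed.

Lemma monomial_value_sub b h F G z r : F \subset G ->
  monomial_value b h F z r -> monomial_value b h G z r.
Proof.
move=> FG [k [p [-> E]]]; exists k, (p * Xprod K (G :\: F) ^+ k); split.
  exact: loc_frac_lift.
rewrite rmorphM /= toric_map_Xprod mulrA E -scalerAl -mpolyXD (set_deg_setD FG).
by congr (_ *: 'X_[_]); mnm_lia.
Qed.

(** K[t] is a domain, so t^h can be cancelled and the numerator lies in the kernel. *)
Lemma monomial_value_toric b h F z : monomial_value b h F z 0 -> localized I F z.
Proof.
move=> [k [p [-> E]]]; exists k, p; split=> //; rewrite mem_toric; apply/eqP.
move/eqP: E; rewrite scale0r mulf_eq0 => /orP[|/eqP //].
by rewrite -msupp_eq0 msuppX.
Qed.

(** * Lifting scalar cocycles to R, and a coefficient test for coboundaries *)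

Definition monomial_cochain b h (u : cochainType) : Prop :=
  forall F, u F = 0 \/ exists k m r, u F = loc_frac F k (r *: 'X_[m]) /\
     (b + set_deg F *+ k = h + toric_deg m)%MM.

Definition has_monomial b h G z : Prop :=
  exists k m r, [/\ r != 0, z = loc_frac G k (r *: 'X_[m]) &
     (b + set_deg G *+ k = h + toric_deg m)%MM].

(** A scalar cocycle [f] is a cocycle of degree b - h for K[S]. Each f(F) t^(b - h) is lifted to a
    monomial fraction of R; the lift is a cocycle modulo I only. *)
Lemma lift_cocycle b h i (f : {set 'I_n} -> K) G :
  (forall F, f F != 0 -> #|F| = i /\ in_loc b h F) ->
  (forall F, wedge (fun=> 1) f F = 0) -> f G != 0 ->
  exists u : cochainType, [/\ cocycle predT I i u, monomial_cochain b h u &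
    has_monomial b h G (u G)].
Proof.
move=> Hf df fG.
have /fin_all_exists[u0 Hu0] : forall F, exists z : Q, if f F == 0 then z = 0 else
    exists k m, z = loc_frac F k (f F *: 'X_[m]) /\
      (b + set_deg F *+ k = h + toric_deg m)%MM.
  move=> F; case: eqP => [_|/eqP/Hf[_ [k [m E]]]]; first by exists 0.
  by exists (loc_frac F k (f F *: 'X_[m])), k, m.
pose u := [ffun F => u0 F]; exists u.
have Hu F : if f F == 0 then u F = 0 else
    exists k m, u F = loc_frac F k (f F *: 'X_[m]) /\
      (b + set_deg F *+ k = h + toric_deg m)%MM by rewrite ffunE; exact: Hu0.
clearbody u; clear u0 Hu0; split; first last.
- by move: (Hu G); rewrite (negPf fG) => -[k [m [E1 E2]]]; exists k, m, (f G).
- move=> F; move: (Hu F); case: ifP => _; first by left.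
  by move=> [k [m E]]; right; exists k, m, (f F).
have cu : cochain predT i u.
  move=> F; move: (Hu F); case: eqP => [_ ->|/eqP fF [k [m [-> _]]]].
    by case: ifP => // _; exact: (localized0 _ (predT_ideal _ _)).
  by have [-> _] := Hf F fF; rewrite eqxx; exists k, (f F *: 'X_[m]).
have vu F : monomial_value b h F (u F) (f F).
  move: (Hu F); case: eqP => [-> ->|_ [k [m [-> E]]]]; first exact: monomial_value0.
  exists k, (f F *: 'X_[m]); split=> //.
  by rewrite toric_mapZ toric_mapX -scalerAr -mpolyXD E.
split=> // {fG}G; move: (cochain_diff (predT_ideal _ _) cu G); case: ifP => // _ _.
(* The coboundary of the lift has image (df)(G) t^(b - h), which is zero. *)
apply: (@monomial_value_toric b h); rewrite -(df G) cech_diffE.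
apply: big_ind2 => [|z1 r1 z2 r2|j jG]; first exact: monomial_value0.
  exact: monomial_valueD.
apply: monomial_value_sign; rewrite !mul1r.
exact: monomial_value_sub (subD1set G j) (vu _).
Qed.

Lemma set_deg1 j : set_deg [set j] = tx j.
Proof.
rewrite /set_deg -toric_degU; congr toric_deg; apply/mnmP => i.
by rewrite set_mnmE inE mnm1E eq_sym.
Qed.

(* The cochain [u - v] is a cocycle of [R], and at [x |: G] the cocycle equation
   writes its value at [G] through fractions over [G :\ j] for [j \in G]. *)
Lemma toric_mcoeff_eq0 b h i (u v : cochainType) G x :
  cochain predT i u -> cochain I i v -> cech_diff u = cech_diff v ->
  #|G| = i -> x \notin G -> (forall j, j \in G -> ~ in_loc b h (G :\ j)) ->
  forall k p y, u G = loc_frac G k p -> (y + h = b + set_deg G *+ k)%MM ->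
  (toric_map p)@_y = 0.
Proof.
move=> Cu Cv duv Gi xG nin k p y uG Ey; apply/eqP/negPn/negP => nz.
pose z := u - v; have IT := predT_ideal K n.
have Cz : cochain predT i z.
  by apply: cochainB => //; apply: cochain_subr Cv.
have [k1 H1] : exists k0, forall k (F : {set 'I_n}), (k0 <= k)%N -> #|F| == i ->
    exists2 p, p \in predT & z F = loc_frac F k p.
  by apply: localized_bound IT _ => F Fi; move: (Cz F); rewrite Fi.
have [k2 H2] : exists k0, forall k (F : {set 'I_n}), (k0 <= k)%N -> #|F| == i ->
    exists2 p, p \in I & v F = loc_frac F k p.
  by apply: localized_bound toric_ideal_like _ => F Fi; move: (Cv F); rewrite Fi.
(* The exponent k0 is common to all the fractions and, being l + k, also allows the given fraction p
   / X_G^k to be raised to it. *)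
pose l := (k1 + k2)%N; pose k0 := (l + k)%N.
have /fin_all_exists[qf Hqf] : forall F, exists q, #|F| = i -> z F = loc_frac F k0 q.
  move=> F; case: (#|F| =P i) => [Fi|]; last by exists 0.
  have [|q _ ->] := H1 k0 F _ (introT eqP Fi); first by rewrite /k0 /l; lia.
  by exists q.
have [|r rI vG] := H2 k0 G _ (introT eqP Gi); first by rewrite /k0 /l; lia.
have pqr : p * Xprod K G ^+ l = qf G + r.
  apply: (@loc_frac_inj _ _ G k0); rewrite loc_fracD -Hqf // -vG -loc_frac_raise -uG.
  by rewrite !ffunE subrK.
pose y' := (set_deg G *+ l + y)%MM.
(* Since r lies in I, the nonzero coefficient of p passes to [qf G]. *)
have nzq : (toric_map (qf G))@_y' != 0.
  move: nz; rewrite -(mcoeffMX _ (set_deg G *+ l) y) -toric_map_Xprod -rmorphM /= pqr.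
  by move: rI; rewrite mem_toric rmorphD /= mcoeffD => /eqP->; rewrite mcoeff0 addr0.
have [m qm my'] := toric_mcoeff_neq0 nzq.
have dz : cech_diff z = 0 by rewrite cech_diffB duv subrr.
pose g j := (-1) ^+ before (x |: G) j * (qf ((x |: G) :\ j) * 'X_[U_(j) *+ k0]).
have cardD j : j \in x |: G -> #|(x |: G) :\ j| = i.
  by move=> jG; move: (cardsU1 x G); rewrite (cardsD1 j) jG xG Gi !add1n => -[].
have sg : \sum_(j in x |: G) g j = 0.
  apply: (@loc_frac_inj _ _ (x |: G) k0); rewrite loc_frac0.
  move/ffunP/(_ (x |: G)): dz; rewrite cech_diffE [RHS]ffunE => <-.
  rewrite /loc_frac rmorph_sum mulr_suml; apply: eq_bigr => j jG /=.
  rewrite mul1r (Hqf _ (cardD j jG)) (loc_frac_lift _ _ (subD1set _ j)).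
  rewrite tofrac_sign loc_fracM /loc_frac; congr (tofrac (_ * (_ * _)) / _).
  rewrite XprodXE; congr 'X_[_ *+ _]; apply/mnmP => t; rewrite set_mnmE mnm1E.
  rewrite !inE; case: (eqVneq j t) => [<-|jt].
    by move: jG; rewrite !inE => ->.
  by rewrite /= andNb.
(* At the monomial X_x^k0 X^m the summand of x contributes the nonzero coefficient of [qf G] at m up
   to sign; a contribution of another j would force X_j^k0 to divide X^m. *)
move/(congr1 (mcoeff (U_(x) *+ k0 + m)%MM)): sg.
rewrite mcoeff0 big_setU1 //= mcoeffD {1}/g setU1K // mcoeff_sign mcoeffMX.
rewrite (raddf_sum (mcoeff _)) big1 ?addr0 => [/eqP|j jG].
  by rewrite mulf_eq0 signr_eq0 (negPf qm).
rewrite /g /= mcoeff_sign; apply/eqP; rewrite mulf_eq0 signr_eq0 /=.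
apply/negPn/negP => /mcoeff_mulX[m' _ Em].
have xj : x != j by apply: contraNneq xG => ->.
have le : (U_(j) *+ k0 <= m)%MM.
  apply/mnm_lepP => t; move/mnmP/(_ t): Em; rewrite !mnmDE !mulmnE !mnm1E.
  by case: (eqVneq j t) => [<-|]; rewrite ?(negPf xj) /=; lia.
(* Cancelling X_j^k0 leaves a fraction of degree b - h whose denominator omits X_j. *)
apply: (nin j jG); exists k0, (m - U_(j) *+ k0)%MM.
have Em' : toric_deg m = (toric_deg (m - U_(j) *+ k0) + tx j *+ k0)%MM.
  by rewrite -toric_degU -toric_degMn -toric_degD submK.
have sG : set_deg G = (set_deg (G :\ j) + tx j)%MM.
  rewrite (set_deg_setD (subD1set G j)) -set_deg1; congr (_ + set_deg _)%MM.
  apply/setP => t; rewrite !inE; case: (eqVneq t j) => [->|] //= _.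
  by rewrite andNb.
rewrite sG in Ey; move: my' Em' Ey; rewrite /y' /k0 sG; clearbody l; clear => A1 A2 A3.
mnm_lia.
Qed.

(** * The variables y_j and the supports of the generators *)

Hypothesis alpha0 : (0 < alpha)%N.
Hypothesis mdeg_a : forall i, mdeg (a i) = alpha.

Lemma tx_rshift j : tx (rshift c j) = pure_power alpha j.
Proof. by rewrite /toric_exponent (unsplitK (inr j)). Qed.

Lemma tx_rshiftE j j' : tx (rshift c j) j' = (alpha * (j == j'))%N.
Proof. by rewrite tx_rshift mulmnE mnm1E mulnC. Qed.

Lemma mdeg_tx k : mdeg (tx k) = alpha.
Proof.
rewrite /toric_exponent; case: (split k) => // j.
by rewrite mdegMn mdeg1 mul1n.
Qed.

Lemma mdeg_toric_deg m : mdeg (toric_deg m) = (alpha * mdeg m)%N.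
Proof.
rewrite mdeg_sum mdegE big_distrr; apply: eq_bigr => k _ /=.
by rewrite mdegMn mdeg_tx.
Qed.

Lemma set_degE F j : set_deg F j = (\sum_(k in F) tx k j)%N.
Proof.
rewrite /set_deg toric_degE [RHS]big_mkcond; apply: eq_bigr => k _ /=.
by rewrite set_mnmE; case: ifP => _; rewrite ?muln1 ?muln0.
Qed.

Definition yset T : {set 'I_n} := [set rshift c j | j in T].

Lemma mem_yset T j : (rshift c j \in yset T) = (j \in T).
Proof. exact: mem_imset (@rshift_inj _ _). Qed.

Lemma yset_setD1 T j : yset (T :\ j) = yset T :\ rshift c j.
Proof.
apply/setP => v; rewrite !inE; apply/imsetP/andP.
  move=> [t]; rewrite !inE => /andP[tj tT] ->.
  by rewrite mem_yset (inj_eq (@rshift_inj _ _)).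
move=> [vj /imsetP[t tT E]]; exists t => //; rewrite !inE tT andbT.
by apply: contra vj => /eqP <-; rewrite E.
Qed.

Lemma set_deg_yset T j : set_deg (yset T) j = (alpha * (j \in T))%N.
Proof.
rewrite set_degE big_imset /=; last by move=> ? ? _ _; exact: rshift_inj.
under eq_bigr do rewrite tx_rshiftE.
have [jT|jT] := boolP (j \in T).
  by rewrite (bigD1 j) //= eqxx big1 ?addn0 // => i /andP[_ /negPf->]; rewrite muln0.
rewrite big1 ?muln0 // => i iT; case: eqP => [E|]; last by rewrite muln0.
by rewrite -E iT in jT.
Qed.

Definition ymon (e : 'X_{1..d}) : 'X_{1..n} := (\sum_j U_(rshift c j) *+ e j)%MM.

Lemma toric_deg_ymon e : toric_deg (ymon e) = (e *+ alpha)%MM.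
Proof.
have -> : toric_deg (ymon e) = (\sum_j tx (rshift c j) *+ e j)%MM.
  rewrite /ymon (big_morph _ toric_degD toric_deg0).
  by apply: eq_bigr => j _; rewrite toric_degMn toric_degU.
apply/mnmP => j; rewrite mnm_sumE mulmnE (bigD1 j) //= big1 => [|i ij].
  by rewrite mulmnE tx_rshiftE eqxx muln1 addn0 mulnC.
by rewrite mulmnE tx_rshiftE (negPf ij) muln0 mul0n.
Qed.

(** Inverting a monomial whose t-support contains T also inverts the y_j, j in T: the degree of its
    power alpha k exceeds that of the k-th power of the product of these y_j by the degree of
    y^e. *)
Lemma in_loc_supp b h F T : (forall j, j \in T -> (0 < set_deg F j)%N) ->
  in_loc b h (yset T) -> in_loc b h F.
Proof.
move=> HF [k [m E]]; pose e := [multinom (k * (set_deg F j - (j \in T)))%N | j < d].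
exists (alpha * k)%N, (m + ymon e)%MM; rewrite toric_degD toric_deg_ymon.
apply/mnmP => j; move/mnmP/(_ j): E; rewrite !(mnmDE, mulmnE) set_deg_yset mnmE.
by move: (HF j); case: (j \in T) => H; nia.
Qed.

(** * Explicit cocycles attached to a face T *)

Definition supp_in T (v : 'I_n) := [forall j, (tx v j != 0%N) ==> (j \in T)].

(* The [om T t], [t \in T], sum to the indicator of the variables supported in [T];
   hence the coboundary of [orient T] lives on the sets [F] whose support strictly
   contains [T]. *)
Definition om T (t : 'I_d) (v : 'I_n) : K :=
  (supp_in T v && ([pick j | tx v j != 0%N] == Some t))%:R.

Lemma om_neq0 T t v : om T t v != 0 -> (0 < tx v t)%N.
Proof.
rewrite /om; case: pickP => [x nz|_]; last by rewrite andbF eqxx.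
have [[<-]|_] := Some x =P Some t; first by rewrite lt0n.
by rewrite andbF eqxx.
Qed.

Lemma supp_in_rshift T t : supp_in T (rshift c t) = (t \in T).
Proof.
apply/forallP/idP => [/(_ t)|tT j]; first by rewrite tx_rshiftE eqxx muln1 -lt0n alpha0.
rewrite tx_rshiftE; case: (t =P j) => [<-|]; first by rewrite tT implybT.
by rewrite muln0 eqxx.
Qed.

Lemma om_rshift T t t' : t \in T -> om T t (rshift c t') = (t == t')%:R.
Proof.
move=> tT; rewrite /om supp_in_rshift.
have -> : [pick j | tx (rshift c t') j != 0%N] = Some t'.
  case: pickP => [j|/(_ t')]; last by rewrite tx_rshiftE eqxx muln1 -lt0n alpha0.
  by rewrite tx_rshiftE; case: (t' =P j) => [->|] //; rewrite muln0 eqxx.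
rewrite eq_sym (inj_eq (@Some_inj _)); case: (t =P t') => [<-|_]; rewrite ?tT //.
by rewrite andbF.
Qed.

(** The image of v has degree alpha > 0, so its support is nonempty and exactly one index is
    picked. *)
Lemma sum_om T v : \sum_(t in T) om T t v = (supp_in T v)%:R.
Proof.
rewrite /om; have [sv|] /= := boolP (supp_in T v); last by rewrite big1.
case: pickP => [j tj|H].
  have jT : j \in T by move/forallP/(_ j): sv; rewrite tj.
  rewrite (bigD1 j) //= eqxx big1 ?addr0 // => t /andP[_ tj'].
  by rewrite (inj_eq (@Some_inj _)) eq_sym (negPf tj').
have : mdeg (tx v) = 0%N by rewrite mdegE big1 // => j _; move/negbFE/eqP: (H j).
by rewrite mdeg_tx => E; move: alpha0; rewrite E.
Qed.

(** An orientation of the face T, extended to sets of |T| variables that need not be y's. *)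
Definition orient T := wedges (om T) (enum T).

Lemma orient_supp T F : orient T F != 0 ->
  #|F| = #|T| /\ forall t, t \in T -> (0 < set_deg F t)%N.
Proof.
move=> /wedges_supp[-> H]; rewrite -cardE; split=> // t tT.
have [|v vF /om_neq0 tv] := H t; first by rewrite mem_enum.
by rewrite set_degE (bigD1 v) //= addn_gt0 tv.
Qed.

(** Each [om T t] is killed against [orient T], so their sum may be subtracted from the form with
    all coefficients 1. *)
Lemma wedge1_orient T F :
  wedge (fun=> 1) (orient T) F = wedge (fun v => (~~ supp_in T v)%:R) (orient T) F.
Proof.
apply/eqP; rewrite -subr_eq0; apply/eqP.
transitivity (wedge (fun v => \sum_(t in T) om T t v) (orient T) F).
  rewrite /wedge -sumrB; apply: eq_bigr => j _; rewrite sum_om.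
  by case: (supp_in T j); rewrite /= ?mul1r ?mul0r ?mulr0 ?subr0 ?subrr.
by rewrite wedge_suml big1 // => t tT; rewrite wedge_wedges // mem_enum.
Qed.

Lemma orient_yset T : exists k : nat, orient T (yset T) = (-1) ^+ k.
Proof.
have [|||k E] := @wedges_sign n K _ (om T) (@rshift c d) (enum T).
- exact: rshift_inj.
- exact: enum_uniq.
- by move=> t t'; rewrite mem_enum; exact: om_rshift.
exists k; rewrite -E; congr (wedges _ _ _); apply/setP => v.
by apply/imsetP/imsetP => -[t tT ->]; exists t; rewrite ?mem_enum // -mem_enum.
Qed.

(** The scalar cocycle is the coboundary of [orient T]. It lives on sets whose support contains some
    l' |: T with l' outside T, where degree b - h is present; [orient T] itself need not live in
    that degree, so the class can be nonzero. *)
Lemma setU1_cocycle T l b h : l \notin T ->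
  (forall l', l' \notin T -> in_loc b h (yset (l' |: T))) ->
  exists u : cochainType, [/\ cocycle predT I #|T|.+1 u, monomial_cochain b h u &
    has_monomial b h (yset (l |: T)) (u (yset (l |: T)))].
Proof.
move=> lT HT; apply: (@lift_cocycle _ _ _ (wedge (fun=> 1) (orient T))).
- move=> F; rewrite wedge1_orient => /wedge_supp[v vF [sv /orient_supp[cF dF]]].
  split; first by rewrite (cardsD1 v) vF cF.
  have : ~~ supp_in T v by move: sv; case: (supp_in T v); rewrite //= eqxx.
  rewrite negb_forall => /existsP[l']; rewrite negb_imply => /andP[l'v l'T].
  apply: in_loc_supp (HT l' l'T) => j; rewrite set_degE (bigD1 v) //= in_setU1.
  case/orP=> [/eqP->|/dF]; first by rewrite addn_gt0 lt0n l'v.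
  rewrite set_degE addn_gt0 => H; apply/orP; right.
  by rewrite (eq_bigl _ _ (fun i => in_setD1 i F v)) in H; under eq_bigl do rewrite andbC.
- by move=> F; rewrite wedgexx.
rewrite wedge1_orient.
have [||||k ->] := @wedge_sign n K (fun v => (~~ supp_in T v)%:R) (orient T)
                             (yset (l |: T)) (rshift c l).
- by rewrite mem_yset setU11.
- by rewrite supp_in_rshift lT.
(* The y_t with t in T are supported in T, so only the summand of l remains. *)
- move=> i /imsetP[t]; rewrite in_setU1 => /orP[/eqP->|tT] ->; first by rewrite eqxx.
  by left; rewrite supp_in_rshift tT.
- by rewrite -yset_setD1 setU1K //; exact: orient_yset.
by rewrite signr_eq0.
Qed.

(** Every variable is supported in the full set, so [orient setT] is already closed. *)
Lemma setT_cocycle b h : in_loc b h (yset setT) ->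
  exists u : cochainType, [/\ cocycle predT I d u, monomial_cochain b h u &
    has_monomial b h (yset setT) (u (yset setT))].
Proof.
move=> HT; apply: (@lift_cocycle _ _ _ (orient setT)).
- move=> F /orient_supp[cF dF]; split; first by rewrite cF cardsT card_ord.
  exact: in_loc_supp HT.
- move=> F; rewrite wedge1_orient /wedge big1 // => v _.
  have -> : supp_in setT v by apply/forallP => j; rewrite inE implybT.
  by rewrite mul0r mulr0.
by have [k ->] := orient_yset setT; rewrite signr_eq0.
Qed.

(** * Classes in the local cohomology of I *)

Lemma monomial_cochain_homog b h e (u : cochainType) (k : 'I_n) :
  monomial_cochain b h u -> (mdeg b)%:Z = (mdeg h)%:Z + alpha%:Z * e ->
  forall F, frac_homog e (u F).
Proof.
move=> mu E F; case: (mu F) => [->|[k0 [m [r [-> Em]]]]]; first exact: frac_homog0.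
exists (mdeg m), (r *: 'X_[m]), (set_mnm F *+ k0)%MM; split.
- by apply: dhomogZ; rewrite dhomogX.
- by rewrite /loc_frac XprodXE.
move/(congr1 mdeg): Em; rewrite !mdegD mdegMn /set_deg !mdeg_toric_deg // mdegMn => Em.
apply: (@mulfI _ (alpha%:Z)); first by rewrite eqz_nat -lt0n.
nia.
Qed.

(** By cross-multiplication, every numerator of z has a single term as its image in K[t]. *)
Lemma has_monomial_coef b h G z k p : has_monomial b h G z -> z = loc_frac G k p ->
  exists k0 m r, [/\ r != 0, (b + set_deg G *+ k0 = h + toric_deg m)%MM &
    forall y, (toric_map p)@_y =
      if (y + set_deg G *+ k0 == toric_deg m + set_deg G *+ k)%MM then r else 0].
Proof.
move=> [k0 [m [r [r0 -> E]]]] /loc_frac_eq/(congr1 toric_map) Ep; exists k0, m, r; split=> // y.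
rewrite -(mcoeffMX _ (set_deg G *+ k0)) -toric_map_Xprod -rmorphM /= -Ep rmorphM /=.
rewrite toric_mapZ toric_mapX toric_map_Xprod -scalerAl -mpolyXD mcoeffZ mcoeffX.
rewrite [in RHS]addmC [X in if X then _ else _]eq_sym.
by case: eqP; rewrite ?mulr1 ?mulr0.
Qed.

Lemma cochain_pred1 i (u : cochainType) : cochain (pred1 (0 : R)) i u -> u = 0.
Proof.
move=> H; apply/ffunP => F; move: (H F); rewrite ffunE; case: ifP => // _.
by move=> [k [p [/eqP-> ->]]]; rewrite tofrac0 mul0r.
Qed.

Lemma pred1_ideal : ideal_like (pred1 (0 : R)).
Proof.
split=> [|p q|p q]; rewrite !inE // => /eqP->; last by rewrite mul0r.
by move=> /eqP->; rewrite addr0.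
Qed.

(** The class used is that of [cech_diff u], the connecting image of u. If it were the coboundary of
    a cochain of I, the coefficient test would kill the monomial of u at G. *)
Lemma local_cohomology_connecting b h i G x e (u : cochainType) :
  cocycle predT I i u -> (forall F, frac_homog e (u F)) ->
  has_monomial b h G (u G) ->
  #|G| = i -> x \notin G -> (forall j, j \in G -> ~ in_loc b h (G :\ j)) ->
  local_cohomology_nonzero I (pred1 0) i.+1 e.
Proof.
move=> [Cu du] hu mG Gi xG nin; exists (cech_diff u); split.
- split=> //; rewrite cech_diffK; exact: cochain0 pred1_ideal.
- move=> F; rewrite ffunE.
  apply: (big_ind (frac_homog e)) => [|z1 z2|j jF]; first exact: frac_homog0 x _.
    exact: frac_homogD.
  exact: frac_homog_sign.
case=> v Cv /cochain_pred1/eqP; rewrite subr_eq0 => /eqP dv.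
have [k0 [m [r [r0 uG E]]]] := mG.
have := toric_mcoeff_eq0 Cu Cv dv Gi xG nin uG (y := toric_deg m).
rewrite addmC -E => /(_ erefl)/eqP.
by rewrite toric_mapZ toric_mapX mcoeffZ mcoeffX eqxx mulr1 (negPf r0).
Qed.

(** * Infinite length from nonempty maximal missing faces *)

Lemma set_degU1 T l : l \notin T ->
  set_deg (yset (l |: T)) = (set_deg (yset T) + tx (rshift c l))%MM.
Proof.
move=> lT; apply/mnmP => j; rewrite mnmDE !set_deg_yset tx_rshiftE in_setU1 eq_sym.
by case: (l =P j) => [<-|]; rewrite ?(negPf lT) ?muln0 ?addn0 ?add0n.
Qed.

(** The y_t with t in T are units here; the numerator y_l^N offsets the extra power of y_l in the
    denominator. *)
Lemma in_loc_shift b h T l N : l \notin T -> in_loc b h (yset (l |: T)) ->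
  in_loc b (h + set_deg (yset T) *+ N) (yset (l |: T)).
Proof.
move=> lT [k [m]]; rewrite set_degU1 // => E.
exists (k + N)%N, (m + U_(rshift c l) *+ N)%MM.
rewrite set_degU1 // toric_degD toric_degMn toric_degU; mnm_lia.
Qed.

Lemma in_loc_unshift b h T N : in_loc b (h + set_deg (yset T) *+ N) (yset T) ->
  in_loc b h (yset T).
Proof.
move=> [k [m E]]; exists k, (m + set_mnm (yset T) *+ N)%MM.
rewrite toric_degD toric_degMn -/(set_deg _); mnm_lia.
Qed.

(** No coefficient of z in a degree b - h - s with s in S. Ranging over all s makes the condition
    stable under multiplication by R. *)
Definition vanishing b h G z : Prop := forall m k p y, z = loc_frac G k p ->
  (y + h + toric_deg m = b + set_deg G *+ k)%MM -> (toric_map p)@_y = 0.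

Lemma vanishing_submodule b h i G : #|G| = i ->
  submodule (fun u : cochainType => cocycle predT I i u /\ vanishing b h G (u G)).
Proof.
move=> Gi; have IT := predT_ideal K n.
have [c0 clin] := cocycle_submodule i IT toric_ideal_like.
split; first split=> //.
  move=> m k p y; rewrite ffunE -(loc_frac0 K G k) => /loc_frac_inj <- _.
  by rewrite rmorph0 mcoeff0.
move=> r u v [cu nu] [cv nv]; split; first exact: clin.
move=> m k p y; rewrite !ffunE => E Ey.
have /(localized_raise IT)[k1 H1] : localized predT G (u G).
  by move: (cu.1 G); rewrite Gi eqxx.
have /(localized_raise IT)[k2 H2] : localized predT G (v G).
  by move: (cv.1 G); rewrite Gi eqxx.
have [|p1 _ uG] := H1 ((k1 + k2) + k)%N; first by lia.
have [|p2 _ vG] := H2 ((k1 + k2) + k)%N; first by lia.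
move: E; rewrite uG vG loc_fracM -loc_fracD (loc_frac_raise _ (k1 + k2) k p).
move=> /loc_frac_inj/(congr1 (mcoeff (set_deg G *+ (k1 + k2) + y)%MM \o toric_map)) /=.
rewrite !(rmorphM, rmorphD) /= toric_map_Xprod mcoeffMX => <-.
rewrite mcoeffD (nv m _ _ _ vG) ?addr0; last by move: Ey; clear => Ey; mnm_lia.
(* A term y1 of the multiplier has degree in S, so its cofactor in u lies in a degree covered by the
   hypothesis on u. *)
rewrite mcoeffM big1 // => -[y1 y2] /= /eqP Ey12.
have [->|/toric_mcoeff_neq0[m1 _ Em1]] := eqVneq ((toric_map r)@_y1) 0; first by rewrite mul0r.
rewrite (nu (m + m1)%MM _ _ _ uG) ?mulr0 //.
rewrite toric_degD Em1; move: Ey Ey12; clear; move: (bmnm y1) (bmnm y2) => x1 x2 Ey Ey12; mnm_lia.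
Qed.

(** u and the cochain u - dv of I have the same differential, so the coefficient test applies to u
    in every degree b - h - s. *)
Lemma coboundary_vanishing b h i G x (u : cochainType) : #|G| = i.+1 -> x \notin G ->
  (forall j, j \in G -> ~ in_loc b h (G :\ j)) -> coboundary predT I i.+1 u ->
  cocycle predT I i.+1 u /\ vanishing b h G (u G).
Proof.
move=> Gi xG nin [v Cv Cuv]; have IT := predT_ideal K n.
have II := toric_ideal_like.
have duv : cech_diff u = cech_diff (u - cech_diff v) by rewrite cech_diffB cech_diffK subr0.
have Cu : cochain predT i.+1 u.
  rewrite -[u](subrK (cech_diff v)) -[X in _ + X]opprK; apply: cochainB => //.
    exact: cochain_subr Cuv.
  rewrite -[- _]add0r; apply: cochainB; [exact: IT|exact: cochain0|exact: cochain_diff].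
split; first by split=> //; rewrite duv; exact: cochain_diff.
move=> m k p y uG E.
apply: (toric_mcoeff_eq0 (b := b) (h := h + toric_deg m) Cu Cuv duv Gi xG _ uG).
  by move=> j jG /in_loc_addh; exact: nin.
by rewrite addmA.
Qed.

Lemma vanishing_deg b h G m z : vanishing b h G z -> vanishing b (h + toric_deg m) G z.
Proof.
move=> H m' k p y /(H (m + m')%MM k p y) {}H E; apply: H.
by move: E; rewrite toric_degD; clear => E; mnm_lia.
Qed.

(** The only degree of z is b - h, and it lies in b - h - e - S only if e = 0. *)
Lemma has_monomial_vanishing b h e G z : has_monomial b h G z ->
  (e != 0)%MM -> vanishing b (h + e) G z.
Proof.
move=> hz e0 m k p y /(has_monomial_coef hz)[k0 [m0 [r [_ E ->]]]] E'.
case: eqP => // E2; case/negP: e0; apply/eqP.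
move: E E' E2; clear => E E' E2.
have : (e + toric_deg m = 0)%MM by mnm_lia.
by move/eqP; rewrite mnmD_eq0 => /andP[/eqP].
Qed.

Lemma has_monomial_nvanishing b h G z : has_monomial b h G z -> ~ vanishing b h G z.
Proof.
move=> [k [m [r [r0 zE E]]]] /(_ 0%MM k _ (toric_deg m) zE).
rewrite toric_deg0 addm0 addmC -E => /(_ erefl)/eqP.
by rewrite toric_mapZ toric_mapX mcoeffZ mcoeffX eqxx mulr1 (negPf r0).
Qed.

(* The powers of the [y_t], [t \in T], shift the class of degree [b - h] to
   infinitely many degrees; the chain of submodules is cut out by the vanishing
   of the coefficients at [G] below more and more negative degrees. *)
Lemma infinite_local_cohomology T b h l (x : 'I_c) : l \notin T -> T != set0 ->
  ~ in_loc b h (yset T) -> (forall l', l' \notin T -> in_loc b h (yset (l' |: T))) ->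
  ~ local_cohomology_finite_length predT I #|T|.+1.
Proof.
move=> lT /set0Pn[t tT] nT HT [B HB].
pose G := yset (l |: T).
have Gi : #|G| = #|T|.+1 by rewrite card_imset ?cardsU1 ?lT //; exact: rshift_inj.
have xG : lshift d x \notin G.
  by apply/negP => /imsetP[j _ /eqP]; rewrite eq_lrshift.
(* The offset (mdeg b) + 1 makes every coordinate s in T of b - hk k negative, so that degree cannot
   occur unless y_s is inverted. *)
pose hk k := (h + set_deg (yset T) *+ ((mdeg b).+1 + k))%MM.
have hkS k : hk k.+1 = (hk k + set_deg (yset T))%MM by rewrite /hk; clear; mnm_lia.
have nin k j : j \in G -> ~ in_loc b (hk k) (G :\ j).
  move=> /imsetP[s]; rewrite in_setU1 => /orP[/eqP->|sT] ->.
    by rewrite -yset_setD1 setU1K // => /in_loc_unshift.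
  rewrite -yset_setD1 => -[k' [m /mnmP/(_ s)]].
  rewrite !(mnmDE, mulmnE) !set_deg_yset sT !inE eqxx /= muln0 mul0n muln1 addn0.
  have : (b s <= mdeg b)%N by rewrite mdegE (bigD1 s) //= leq_addr.
  by move: alpha0 (b s) (mdeg b) (h s) (toric_deg _ _) => + x1 x2 x3 x4; nia.
pose W k (u : cochainType) := cocycle predT I #|T|.+1 u /\ vanishing b (hk k) G (u G).
suff : (B.+1 <= B)%N by rewrite ltnn.
apply: (HB _ W) => k kB.
  split; [exact: vanishing_submodule | | by move=> u []].
  move=> u; exact: (coboundary_vanishing Gi xG (nin k)).
split=> [u [cu nu]|]; first by split; rewrite // hkS; exact: vanishing_deg.
have [l' l'T|u [cu _ mu]] := @setU1_cocycle T l b (hk k) lT.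
  by apply: in_loc_shift => //; exact: HT.
exists u; split; last by case=> _; exact: has_monomial_nvanishing mu.
split=> //; rewrite hkS; apply: has_monomial_vanishing mu _.
apply/eqP => /mnmP/(_ t); rewrite set_deg_yset tT muln1 mnm0E => E.
by move: alpha0; rewrite E.
Qed.

(** * A chain of primes above the toric ideal *)

Definition trunc_vars (k : nat) : d.-tuple {mpoly K[d]} :=
  [tuple if (j < k)%N then 0 else 'X_j | j < d].

Lemma comp_mpoly_trunc k l (q : {mpoly K[d]}) : (k <= l)%N ->
  q \mPo trunc_vars k \mPo trunc_vars l = q \mPo trunc_vars l.
Proof.
move=> kl; rewrite (mpolyE q) (raddf_sum (comp_mpoly (trunc_vars k))).
rewrite !(raddf_sum (comp_mpoly (trunc_vars l))) /=.
apply: eq_bigr => m _; rewrite !comp_mpolyZ !comp_mpolyX rmorph_prod; congr (_ *: _).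
apply: eq_bigr => j _; rewrite rmorphXn /= !tnth_mktuple; congr (_ ^+ _).
case: ltnP => jk; first by rewrite comp_mpoly0 (leq_trans jk kl).
by rewrite comp_mpolyXU -tnth_nth tnth_mktuple.
Qed.

Definition coord_prime (k : nat) : {pred R} :=
  [pred p | toric_map p \mPo trunc_vars k == 0].

(** Setting the first k of the t_j to zero maps R to a domain, so the kernels are primes; the next
    y-variable separates consecutive ones. *)
Lemma lt_krull_dim_toric i : (i < d)%N -> lt_krull_dim I i.
Proof.
move=> id; exists coord_prime; split=> k kd.
  split.
  - split=> [||r u v]; rewrite !inE ?rmorph0 ?comp_mpoly0 ?eqxx //.
      by rewrite rmorph1 comp_mpoly1 oner_eq0.
    move=> /eqP u0 /eqP v0.
    by rewrite rmorphD rmorphM /= comp_mpolyD v0 rmorphM /= u0 mulr0 addr0.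
  - by move=> u v; rewrite !inE !rmorphM /= mulf_eq0.
  - by move=> p; rewrite mem_toric !inE => /eqP->; rewrite comp_mpoly0.
have kd' : (k < d)%N by lia.
split.
  move=> p; rewrite !inE => /eqP p0; rewrite -(comp_mpoly_trunc _ (leqnSn k)) p0.
  by rewrite comp_mpoly0.
exists 'X_(rshift c (Ordinal kd')); rewrite !inE toric_mapX toric_degU tx_rshift.
  rewrite comp_mpolyX (bigD1 (Ordinal kd')) //= tnth_mktuple ltnSn mulmnE mnm1E eqxx mul1n.
  by rewrite expr0n eqn0Ngt alpha0 mul0r.
rewrite comp_mpolyX (bigD1 (Ordinal kd')) //= tnth_mktuple ltnn mulmnE mnm1E eqxx mul1n.
rewrite big1 ?mulr1 => [|j jk]; last by rewrite mulmnE mnm1E eq_sym (negPf jk) mul0n expr0.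
by rewrite mpolyXn -msupp_eq0 msuppX.
Qed.

(** * Degrees of sets of variables, and faces at which a multidegree is missing *)

Lemma mdeg_set_deg F : mdeg (set_deg F) = (alpha * #|F|)%N.
Proof.
rewrite /set_deg mdeg_toric_deg // mdeg_sum; congr (_ * _)%N.
by under eq_bigr do rewrite mdeg1; rewrite sum1_card.
Qed.

Lemma card_yset T : #|yset T| = #|T|.
Proof. by rewrite card_imset //; exact: rshift_inj. Qed.

Lemma in_loc_set0 b h : in_loc b h (yset set0) -> exists m, b = (h + toric_deg m)%MM.
Proof.
move=> [k [m E]]; exists m; rewrite -E; apply/mnmP => j.
by rewrite mnmDE mulmnE set_deg_yset inE muln0 mul0n addn0.
Qed.

Lemma in_loc_mem b h m T j : j \in T -> (b + tx (rshift c j) = h + toric_deg m)%MM ->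
  in_loc b h (yset T).
Proof.
move=> jT E; exists 1%N, (m + set_mnm (yset (T :\ j)))%MM.
rewrite -{1}(setD1K jT) set_degU1 ?setD11 // toric_degD -/(set_deg _).
mnm_lia.
Qed.

Lemma max_face b h T0 : ~ in_loc b h (yset T0) -> exists T,
  ~ in_loc b h (yset T) /\ forall l, l \notin T -> in_loc b h (yset (l |: T)).
Proof.
have [N] := ubnP (d - #|T0|)%N; elim: N T0 => // N IH T0 HN nT0.
have [[l [lT nl]]|H] := classic (exists l, l \notin T0 /\ ~ in_loc b h (yset (l |: T0))).
  apply: (IH (l |: T0)) => //; rewrite cardsU1 lT.
  have := max_card (l |: T0); rewrite cardsU1 lT card_ord; lia.
exists T0; split=> // l lT; apply: NNPP => nl; apply: H; by exists l.
Qed.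

Hypothesis hgCM : generalized_Cohen_Macaulay_quotient I.
Hypothesis x : 'I_c.

Lemma lshift_notin_yset T : lshift d x \notin yset T.
Proof. by apply/negP => /imsetP[j _ /eqP]; rewrite eq_lrshift. Qed.

(** A nonempty maximal missing face T would give H^(|T|+1) infinite length with |T| + 1 < d. Hence
    the maximal one is empty, and every single vertex carries the degree. *)
Lemma in_loc_set1 b h : ~ in_loc b h (yset set0) ->
  (forall T, ~ in_loc b h (yset T) -> (#|T|.+1 < d)%N) ->
  forall l, in_loc b h (yset [set l]).
Proof.
move=> n0 HT l; have [T [nT HTl]] := max_face n0.
have [T0|T0] := eqVneq T set0; first by rewrite -(setU0 [set l]) -T0; apply: HTl; rewrite T0 inE.
have [l' l'T] : exists l', l' \notin T.
  apply/existsP; rewrite -negb_forall; apply/negP => /forallP HT'.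
  have : #|T| = d by rewrite (eq_card (B := predT)) ?card_ord.
  by have := HT T nT; lia.
have fl : local_cohomology_finite_length predT I #|T|.+1.
  by apply: hgCM; apply: lt_krull_dim_toric; rewrite ?HT.
by case: (infinite_local_cohomology x l'T T0 nT HTl fl).
Qed.

(** * Lower bounds for the regularity *)

Variable r : int.
Hypothesis hr : forall (s : int) (i : nat),
  local_cohomology_nonzero I (pred1 0) i (s - i%:Z) -> s <= r.

(** A class of R/I in H^i and degree e gives one of I in H^(i+1) and degree e. The variable outside
    G required by the test is an x-variable. *)
Lemma regularity_bound b h i G e (u : {ffun {set 'I_n} -> {fraction R}}) :
  cocycle predT I i u -> monomial_cochain b h u ->
  has_monomial b h G (u G) -> #|G| = i -> lshift d x \notin G ->
  (forall j, j \in G -> ~ in_loc b h (G :\ j)) ->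
  (mdeg b)%:Z = (mdeg h)%:Z + alpha%:Z * e -> e + i%:Z + 1 <= r.
Proof.
move=> cu mu mG Gi xG nin E; apply: (hr (i := i.+1)).
have -> : e + i%:Z + 1 - i.+1%:Z = e by lia.
by apply: local_cohomology_connecting cu (monomial_cochain_homog (lshift d x) mu E) mG Gi xG nin.
Qed.

Lemma regularity_bound_H1 b h e : ~ in_loc b h (yset set0) ->
  (forall T, ~ in_loc b h (yset T) -> (#|T|.+1 < d)%N) ->
  (mdeg b)%:Z = (mdeg h)%:Z + alpha%:Z * e -> e + 2 <= r.
Proof.
move=> n0 HT E; have H1 := in_loc_set1 n0 HT.
have d0 : (0 < d)%N by have := HT _ n0; lia.
pose l := Ordinal d0.
have [||u [cu mu hu]] := @setU1_cocycle set0 l b h.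
- by rewrite inE.
- by move=> l' _; rewrite setU0; exact: H1.
have -> : e + 2 = e + 1%:Z + 1 by lia.
rewrite cards0 in cu; apply: (regularity_bound cu mu hu) E.
- by rewrite card_yset setU0 cards1.
- exact: lshift_notin_yset.
move=> j; rewrite setU0 => /imsetP[t]; rewrite inE => /eqP-> ->.
by rewrite -yset_setD1 setDv.
Qed.

Lemma regularity_bound_Hd b h e : in_loc b h (yset setT) ->
  (forall j, ~ in_loc b h (yset (setT :\ j))) ->
  (mdeg b)%:Z = (mdeg h)%:Z + alpha%:Z * e -> e + d%:Z + 1 <= r.
Proof.
move=> HT nin E; have [u [cu mu hu]] := @setT_cocycle b h HT.
apply: (regularity_bound cu mu hu) E.
- by rewrite card_yset cardsT card_ord.
- exact: lshift_notin_yset.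
by move=> j /imsetP[t _ ->]; rewrite -yset_setD1.
Qed.

(** * Minimal generators of the initial ideal *)

Lemma initial_ideal_binomial (m1 m2 : 'X_{1..n}) : toric_deg m1 = toric_deg m2 -> revlex_lt m1 m2 ->
  initial_ideal I 'X_[m2].
Proof.
move=> E lt12; exists [:: (1, m2)]; split; last by rewrite big_seq1 mul1r.
have ne : m1 != m2.
  by apply/eqP => E12; rewrite E12 in lt12; case: lt12 => [|[_ [i []]]]; rewrite ltnn.
move=> t; rewrite inE => /eqP->; exists ('X_[m2] - 'X_[m1]).
  by rewrite mem_toric rmorphB /= !toric_mapX E subrr.
split=> [|m']; rewrite mcoeff_msupp mcoeffB !mcoeffX /=.
  by rewrite eqxx (negPf ne) subr0 oner_eq0.
by move=> + /negPf nm'; rewrite [m2 == _]eq_sym nm' sub0r;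
   case: (m1 =P m') => [<-//|_]; rewrite oppr0 eqxx.
Qed.

Lemma min_generator_lead (m : 'X_{1..n}) : min_generator (initial_ideal I) m ->
  exists2 m1, toric_deg m1 = toric_deg m & m1 != m /\ revlex_lt m1 m.
Proof.
move=> [[s [Hs Es]] Hm].
have [t [ts Et]] : exists t, t \in s /\ (t.1 * 'X_[t.2])@_m != 0.
  apply: NNPP => H; have := congr1 (mcoeff m) Es.
  rewrite mcoeffX eqxx (raddf_sum (mcoeff m)) big_seq big1 => [/eqP|t ts].
    by rewrite oner_eq0.
  by apply/eqP/negPn/negP => nz; apply: H; exists t.
have [m' _ mE] := mcoeff_mulX Et.
have [f fI lf] := Hs t ts.
(* Some leading monomial divides m, and minimality makes it equal to m. *)
have t2m : t.2 = m.
  apply: Hm; last by rewrite mE; exact: lem_addl.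
  exists [:: (1, t.2)]; split; last by rewrite big_seq1 mul1r.
  by move=> t'; rewrite inE => /eqP->; exists f.
move: lf; rewrite t2m => -[mf lf].
(* The image of f is zero, so the term of m must cancel against another one of the same
   multidegree. *)
have [m1 [m1f m1m Em1]] : exists m1, [/\ m1 \in msupp f, m1 != m & toric_deg m1 = toric_deg m].
  apply: NNPP => H; move: fI (mf); rewrite mem_toric mcoeff_msupp => /eqP f0 /negP.
  apply; apply/eqP.
  move/(congr1 (mcoeff (toric_deg m))): f0; rewrite mcoeff0 mcoeff_toric => <-.
  rewrite (big_rem m mf) /= eqxx big_seq_cond big1 ?addr0 // => m1.
  rewrite mem_rem_uniq ?msupp_uniq // inE => /andP[/andP[h1 h2] /eqP h3].
  by case: H; exists m1.
by exists m1; last split; last exact: lf.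
Qed.

Lemma last_index (i0 : 'I_n) (P : pred 'I_n) : P i0 ->
  exists i : 'I_n, [/\ P i, (i0 <= i)%N & forall j : 'I_n, (i < j)%N -> ~~ P j].
Proof.
move=> Pi0; case: (arg_maxnP (fun i : 'I_n => i : nat) Pi0) => i Pi H; exists i; split=> //.
  exact: H.
by move=> j ij; apply/negP => /H ji; move: (leq_trans ij ji); rewrite ltnn.
Qed.

(** The monomial y_k m1 has the multidegree of m and involves a variable after v, which m does not;
    it is therefore smaller in the reverse lexicographic order. *)
Lemma revlex_initial_pivot (m m1 : 'X_{1..n}) (v : 'I_n) k :
  (forall j : 'I_n, (v < j)%N -> m j = 0%N) ->
  (v < rshift c k)%N -> toric_deg m = (tx (rshift c k) + toric_deg m1)%MM ->
  initial_ideal I 'X_[m].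
Proof.
move=> mv vk E; pose m2 := (U_(rshift c k) + m1)%MM.
have Em2 : toric_deg m2 = toric_deg m by rewrite toric_degD toric_degU E.
apply: (initial_ideal_binomial Em2); right; split.
  move/(congr1 mdeg): Em2; rewrite !mdeg_toric_deg // => /eqP.
  by rewrite eqn_pmul2l // => /eqP.
have [|i [mi ki Hi]] := @last_index (rshift c k) (fun j => m2 j != m j).
  by rewrite mnmDE mnm1E eqxx mv.
exists i; have m0 := mv i (leq_trans vk ki); split; first by move: mi; rewrite m0 lt0n.
by move=> j /Hi/negPn/eqP.
Qed.

Lemma min_generator_bound (m : 'X_{1..n}) : min_generator (initial_ideal I) m -> (mdeg m)%:Z <= r.
Proof.
move=> mg; have [m1 Em1 [m1m lt1]] := min_generator_lead mg.
have Ed : mdeg m1 = mdeg m.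
  by move/(congr1 mdeg)/eqP: Em1; rewrite !mdeg_toric_deg // eqn_pmul2l // => /eqP.
have [v0 mv0] : exists v, m v != 0%N.
  apply/existsP; apply: contraNT m1m; rewrite negb_exists => /forallP m0.
  have m00 : m = 0%MM by apply/mnmP => v; rewrite mnm0E; move/negPn/eqP: (m0 v).
  by rewrite m00 -mdeg_eq0 Ed m00 mdeg0.
have [v [mv _ Hv]] := @last_index v0 (fun j => m j != 0%N) mv0.
pose m' := (m - U_(v))%MM.
have mE : m = (m' + U_(v))%MM by rewrite /m' submK // lep1mP.
have dm : mdeg m = (mdeg m').+1 by rewrite mE mdegD mdeg1 addn1.
have nI : ~ initial_ideal I 'X_[m'].
  move=> Im'; have E := mg.2 m' Im' (lem_subr _ _).
  by move: dm; rewrite E; lia.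
have Hv' (j : 'I_n) : (v < j)%N -> m' j = 0%N.
  by move=> /Hv; rewrite negbK => /eqP E; rewrite mnmBE E.
have n0 k : (v < rshift c k)%N -> ~ in_loc (toric_deg m') (tx (rshift c k)) (yset set0).
  by move=> vk /in_loc_set0[m2 E]; apply: nI; exact: revlex_initial_pivot Hv' vk E.
have nmem k T : ~ in_loc (toric_deg m') (tx (rshift c k)) (yset T) -> k \notin T.
  by move=> nT; apply/negP => kT; apply: nT; apply: (@in_loc_mem _ _ m') kT _; rewrite addmC.
have H1 k : (v < rshift c k)%N ->
    (forall T, ~ in_loc (toric_deg m') (tx (rshift c k)) (yset T) -> (#|T|.+1 < d)%N) ->
    (mdeg m)%:Z <= r.
  move=> vk HT; have := regularity_bound_H1 (e := (mdeg m')%:Z - 1) (n0 k vk) HT.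
  rewrite mdeg_toric_deg // mdeg_tx // dm => H; suff : (mdeg m')%:Z - 1 + 2 <= r by lia.
  by apply: H; lia.
(* If v is some x_i, every y_k comes after it, so any k may serve as pivot. *)
case: (split_ordP v) => v' vE.
  have vk k : (v < rshift c k)%N by rewrite vE /= (leq_trans (ltn_ord v')) // leq_addr.
  have [[k Hk]|Hk] := classic (exists k,
    in_loc (toric_deg m') (tx (rshift c k)) (yset (setT :\ k))).
    apply: (H1 k) => // T nT; have kT := nmem k T nT.
    have : T \proper (setT :\ k).
      rewrite properEneq subsetD1 subsetT kT !andbT; apply: contra_not_neq nT => ->.
      exact: Hk.
    move/proper_card => Tk; have := cardsD1 k [set: 'I_d].
    by rewrite cardsT card_ord in_setT add1n => dE; rewrite [ltnRHS]dE ltnS.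
  (* Subtracting all the alpha e_k at once lands in degree deg m' - d, where only the full face
     carries the multidegree. *)
  have := @regularity_bound_Hd (toric_deg m') (set_deg (yset setT)) ((mdeg m')%:Z - d%:Z).
  rewrite mdeg_toric_deg // mdeg_set_deg card_yset cardsT card_ord dm => H.
  suff : (mdeg m')%:Z - d%:Z + d%:Z + 1 <= r by lia.
  apply: H; last by nia.
    by exists 1%N, m'; rewrite mulm1n addmC.
  move=> k Hj; apply: Hk; exists k.
  apply: (@in_loc_addh _ _ (set_mnm (yset (setT :\ k)))).
  by rewrite -/(set_deg _) addmC -set_degU1 ?setD11 // setD1K ?inE.
case: lt1 => [|[_ [i [mi Hi]]]]; first by rewrite Ed ltnn.
(* If i <= v, then v divides m1 as well, and dividing both monomials by v puts m' in the initial
   ideal. *)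
have [iv|vi] := leqP i v.
  have m1v : m1 v != 0%N.
    move: iv; rewrite leq_eqVlt => /orP[/eqP/val_inj <-|/Hi->//].
    by rewrite -lt0n (leq_ltn_trans _ mi).
  case: nI; apply: (@initial_ideal_binomial (m1 - U_(v))%MM).
    move: Em1; rewrite mE -{1}(submK (m := U_(v)) (m' := m1)) ?lep1mP // !toric_degD => E.
    by clear -E; mnm_lia.
  right; split.
    have := Ed; rewrite mE -{1}(submK (m := U_(v)) (m' := m1)) ?lep1mP // !mdegD; lia.
  exists i; split=> [|j /Hi]; rewrite !mnmBE; last by move=> ->.
  move: mi m1v mv; rewrite mnm1E; case: (v =P i) => [->|_]; lia.
case: (split_ordP i) => k iE.
  by move: vi; rewrite vE iE /= ltnNge (leq_trans (ltnW (ltn_ord k))) ?leq_addr.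
have jk : v' != k by apply/eqP => jk; move: vi; rewrite vE iE jk ltnn.
apply: (H1 k); rewrite -?iE // iE => T nT.
have kT := nmem k T nT.
(* The monomial m1 / y_k witnesses s - alpha e_k + alpha e_j in S, with s the multidegree of m'.
   Thus T omits both j and k. *)
have jT : v' \notin T.
  apply/negP => jT; apply: nT; apply: (@in_loc_mem _ _ (m1 - U_(i))%MM) jT _.
  rewrite -vE -iE -[in RHS]toric_degU -!toric_degU -!toric_degD -mE addmC submK ?Em1 //.
  by rewrite lep1mP -lt0n (leq_ltn_trans _ mi).
move: (max_card (v' |: (k |: T))); rewrite !cardsU1 in_setU1
  (negPf jk) (negPf jT) kT card_ord !add1n; apply.
Qed.
End Toric.

Theorem lemma2p1 (K : fieldType) (c alpha d : nat) (a : 'I_c -> 'X_{1..d})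
    (hc : (2 <= c)%N) (halpha : (2 <= alpha)%N)
    (hA : simplicial_data alpha a)
    (hgCM : generalized_Cohen_Macaulay_quotient (toric_ideal K alpha a))
    (D : nat) (hD : max_revlex_groebner_degree (toric_ideal K alpha a) D)
    (r : int) (hr : regularity_ideal (toric_ideal K alpha a) r) :
  D%:Z <= r.
Proof.
have [[m mg <-] _] := hD; have [_ hr2] := hr; have [hdeg _ _ _] := hA.
exact: (min_generator_bound (ltnW halpha) hdeg hgCM (Ordinal (ltnW hc)) hr2 mg).
Qed.
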